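(* Consider the Stackelberg setup of the scalar quadratic Gaussian signaling game with source $m\sim\mathcal{N}(0,\mathbb{E}[m^2])$, channel noise $w\sim\mathcal{N}(0,\mathbb{E}[w^2])$ independent of $m$ (both variances positive), encoder cost $(m-u-b)^2+\lambda x^2$ and decoder cost $(m-u)^2$, with $b\in\mathbb{R}$, $\lambda>0$. Then the only Stackelberg equilibrium is the linear equilibrium; i.e., a Stackelberg equilibrium with linear policies exists and every Stackelberg equilibrium has linear policies.
   Context: The encoder observes $m$ and sends a real-valued $x=\gamma^e(m)$; the decoder receives $y=x+w$ and chooses $u=\gamma^d(y)\in\mathbb{R}$; policies are measurable functions. $J^e(\gamma^e,\gamma^d)=\mathbb{E}[(m-u-b)^2+\lambda x^2]$ and $J^d(\gamma^e,\gamma^d)=\mathbb{E}[(m-u)^2]$, both to be minimized. Stackelberg equilibrium: the encoder's policy is announced first and the decoder best-responds to it. A pair $(\gamma^{*,e},\gamma^{*,d})$ is a Stackelberg equilibrium if $J^e(\gamma^{*,e},\gamma^{*,d}(\gamma^{*,e}))\le J^e(\gamma^e,\gamma^{*,d}(\gamma^e))$ for all encoder policies $\gamma^e$, where $\gamma^{*,d}(\gamma^e)$ satisfies $J^d(\gamma^e,\gamma^{*,d}(\gamma^e))\le J^d(\gamma^e,\gamma^d(\gamma^e))$ for all decoder policies $\gamma^d$. Linear policies: $\gamma^e(m)=Am$ and $\gamma^d(y)=Ky$ with $A,K\in\mathbb{R}$ (the degenerate case $A=K=0$ is allowed). Policies are identified when they agree almost surely. *)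

(* Defs.v *)
From HB Require Import structures.
From mathcomp Require Import all_boot all_order all_algebra.
From mathcomp Require Import all_classical all_reals all_analysis.
Set Implicit Arguments.
Unset Strict Implicit.
Unset Printing Implicit Defensive.
Import Order.TTheory GRing.Theory Num.Theory.
Import numFieldNormedType.Exports.
Local Open Scope classical_set_scope.
Local Open Scope ring_scope.

(* [normal_prob] takes the standard deviation, not the variance, as its second
   argument.  Laws are compared on measurable sets only: outside them the
   values of the set functions carry no meaning. *)
Definition centered_gaussian (d : measure_display) (T : measurableType d)
    (R : realType) (P : probability T R) (X : {RV P >-> R}) (v : R) : Prop :=
  forall B : set R, measurable B ->
    distribution P X B = normal_prob 0 (Num.sqrt v) B.

Definition independent_RVs (d : measure_display) (T : measurableType d)
    (R : realType) (P : probability T R) (X Y : {RV P >-> R}) : Prop :=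
  forall A B : set R, measurable A -> measurable B ->
    (P (X @^-1` A `&` Y @^-1` B) = P (X @^-1` A) * P (Y @^-1` B))%E.

Definition policy (R : realType) : Type := {mfun R >-> R}.

Definition channel_output (d : measure_display) (T : measurableType d)
    (R : realType) (P : probability T R) (m w : {RV P >-> R})
    (ge : policy R) (t : T) : R :=
  ge (m t) + w t.

(* Costs are expectations of nonnegative functions, so they are defined in
   [\bar R] for all policies, with value [+oo] when the integral diverges. *)
Definition encoder_cost (d : measure_display) (T : measurableType d)
    (R : realType) (P : probability T R) (m w : {RV P >-> R}) (b lambda : R)
    (ge gd : policy R) : \bar R :=
  'E_P[(fun t => (m t - gd (channel_output m w ge t) - b) ^+ 2
                 + lambda * ge (m t) ^+ 2)%R]%E.

Definition decoder_cost (d : measure_display) (T : measurableType d)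
    (R : realType) (P : probability T R) (m w : {RV P >-> R})
    (ge gd : policy R) : \bar R :=
  'E_P[(fun t => (m t - gd (channel_output m w ge t)) ^+ 2)%R]%E.

(* The decoder moves after the encoder's policy is announced, so its strategy
   [br] maps every encoder policy, also off the equilibrium path, to a decoder
   policy. *)
Definition stackelberg_equilibrium (d : measure_display) (T : measurableType d)
    (R : realType) (P : probability T R) (m w : {RV P >-> R}) (b lambda : R)
    (ge : policy R) (br : policy R -> policy R) : Prop :=
  (forall (ge' gd : policy R),
     (decoder_cost m w ge' (br ge') <= decoder_cost m w ge' gd)%E) /\
  (forall ge' : policy R,
     (encoder_cost m w b lambda ge (br ge)
      <= encoder_cost m w b lambda ge' (br ge'))%E).

Definition linear_policy (R : realType) (g : policy R) : Prop :=
  exists A : R, forall x : R, g x = A * x.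

(* Linearity up to almost sure equality, [X] being the policy's observation. *)
Definition linear_policy_as (d : measure_display) (T : measurableType d)
    (R : realType) (P : probability T R) (X : T -> R) (g : policy R) : Prop :=
  exists A : R, {ae P, forall t, g (X t) = A * X t}.

(* Main.v *)
Require Import Defs.
From HB Require Import structures.
From mathcomp Require Import all_boot all_order all_algebra.
From mathcomp Require Import all_classical all_reals all_analysis.
From mathcomp Require Import measurable_realfun.
From mathcomp Require Import ring lra.
Set Implicit Arguments.
Unset Strict Implicit.
Unset Printing Implicit Defensive.
Import Order.TTheory GRing.Theory Num.Theory.
Import numFieldNormedType.Exports.
Local Open Scope classical_set_scope.
Local Open Scope ring_scope.

(** A best-responding decoder has an error of mean zero, so the bias only adds
    [b ^+ 2] to the encoder cost, which becomes [b ^+ 2] plus the mean square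
    error plus [lambda] times the power of [f := ge].  Let [S] be the output
    variance of the best linear pair and [D := vm * vw / S] its error, so that
    [D / S <= lambda].  Compare the joint law of source [x] and output [y] with
    the Gaussian model in which [y ~ N(0, S)] and [x ~ N(g y, D)]: the density
    ratio [exp u], [u := log_ratio x y], has expectation [1], while [2 * u] is
    the quadratic expression
    [x^2 / vm + (y - f x)^2 / vw - (x - g y)^2 / D - y^2 / S].
    Integrating [1 + u <= exp u] gives
    [E[(x - g y)^2] / D + E[y^2] / S >= 2], which is the optimal bound because
    [E[y^2] = E[(f x)^2] + vw].  In the equality case [u = 0] for almost all
    [(x, y)], and comparing coefficients forces [f] and [g] to be linear. *)

(** * Gaussian measures: densities, symmetry and second moments *)

Section gaussian_integrals.
Context {R : realType}.
Implicit Types (f : measurableTypeR R -> \bar R) (s : R).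
Local Notation leb := (@lebesgue_measure R).

Import HBNNSimple.

(** Holds on indicators by definition of [normal_prob], on simple functions by linearity, and in
    general by monotone convergence along [nnsfun_approx]. *)
Lemma ge0_integral_normal_prob (a s : R) f :
  measurable_fun setT f -> (forall x, 0 <= f x)%E ->
  (\int[normal_prob a s]_x f x = \int[leb]_x (f x * (normal_pdf a s x)%:E))%E.
Proof.
move=> mf f0.
have mp : measurable_fun setT (fun x => (normal_pdf a s x)%:E).
  by apply/measurable_EFinP; exact: measurable_normal_pdf.
have p0 x : (0 <= (normal_pdf a s x)%:E)%E by rewrite lee_fin normal_pdf_ge0.
have indic E : measurable E ->
  (\int[normal_prob a s]_x (\1_E x)%:E =
   \int[leb]_x ((\1_E x)%:E * (normal_pdf a s x)%:E))%E.
  move=> mE; rewrite integral_indic// setIT.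
  transitivity (\int[leb]_(x in E) (normal_pdf a s x)%:E)%E; first by [].
  rewrite integral_mkcond/=.
  apply: eq_integral => x _; rewrite patchE indicE.
  by case: ifPn => _; rewrite ?mul1e ?mul0e.
pose g := nnsfun_approx measurableT mf.
have sfun (h : {nnsfun _ >-> R}) :
  (\int[normal_prob a s]_x (h x)%:E =
   \int[leb]_x ((h x)%:E * (normal_pdf a s x)%:E))%E.
  under [LHS]eq_integral do rewrite fimfunE -fsumEFin//.
  rewrite ge0_integral_fsum//; last 2 first.
  - by move=> r; exact/measurable_EFinP/measurableT_comp.
  - by move=> n x _; rewrite EFinM nnfun_muleindic_ge0.
  under [RHS]eq_integral.
    move=> x _; rewrite fimfunE -fsumEFin// ge0_mule_fsuml; last first.
      by move=> r; rewrite EFinM nnfun_muleindic_ge0.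
    over.
  rewrite ge0_integral_fsum//; last 2 first.
  - move=> r; apply: emeasurable_funM => //.
    by apply/measurable_EFinP; exact: measurableT_comp.
  - by move=> n x _; rewrite mule_ge0// EFinM nnfun_muleindic_ge0.
  apply: eq_fsbigr => r hr.
  have r0 : (0 <= r)%R by move/set_mem : hr => [t _ <-]; exact: fun_ge0.
  under eq_integral do rewrite EFinM.
  rewrite ge0_integralZl//; last exact/measurable_EFinP/measurable_indic.
  rewrite indic//.
  rewrite -ge0_integralZl//; last 2 first.
  - apply: emeasurable_funM => //; exact/measurable_EFinP/measurable_indic.
  - by move=> x _; rewrite mule_ge0.
  by apply: eq_integral => x _; rewrite muleA -EFinM.
transitivity (lim (\int[normal_prob a s]_x (g n x)%:E @[n --> \oo])%E).
  rewrite -monotone_convergence//=.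
  - apply: eq_integral => ? /[!inE] xD; apply/esym/cvg_lim => //=.
    exact: cvg_nnsfun_approx.
  - by move=> n; exact/measurable_EFinP/measurable_funTS.
  - by move=> n ? _; rewrite lee_fin.
  - by move=> ? _ ? ? mn; rewrite lee_fin; exact/lefP/nd_nnsfun_approx.
under eq_fun do rewrite sfun.
rewrite -monotone_convergence//=.
- apply: eq_integral => x _; apply/cvg_lim => //=.
  apply: cvgeZr => //; exact: cvg_nnsfun_approx.
- move=> n; apply: emeasurable_funM => //; exact/measurable_EFinP/measurable_funTS.
- by move=> n x _; rewrite mule_ge0// lee_fin.
- move=> x _ n k nk; apply: lee_wpmul2r => //.
  by rewrite lee_fin; exact/lefP/nd_nnsfun_approx.
Qed.

(** The image of Lebesgue measure under a translation gives half-open intervals their length, so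
    uniqueness identifies it with Lebesgue measure. *)
Lemma ge0_integral_lebesgueD (a : R) f :
  measurable_fun setT f -> (forall x, 0 <= f x)%E ->
  (\int[leb]_x f (a + x)%R = \int[leb]_x f x)%E.
Proof.
move=> mf f0.
have mD : @measurable_fun _ _ (measurableTypeR R) (measurableTypeR R) setT (+%R a).
  exact: measurable_funD.
have := @ge0_integral_pushforward _ _ _ _ R _ mD leb setT f measurableT mf
  (fun x _ => f0 x).
rewrite preimage_setT => <-.
apply: eq_measure_integral => A mA _.
apply/esym/lebesgue_measure_unique => //= _ [[u v]] _ <-.
rewrite /pushforward.
have -> : +%R a @^-1` `]u, v] = `]u - a, v - a]%classic.
  apply/seteqP; split=> x /=; rewrite !in_itv/= => /andP[h1 h2]; lra.
rewrite !lebesgue_measure_itv/= !lte_fin ltrD2r.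
by case: ifP => // _; rewrite -!EFinB; congr EFin; ring.
Qed.

Lemma ge0_integral_lebesgueN f :
  measurable_fun setT f -> (forall x, 0 <= f x)%E ->
  (\int[leb]_x f (- x)%R = \int[leb]_x f x)%E.
Proof.
move=> mf f0.
have mN : @measurable_fun _ _ (measurableTypeR R) (measurableTypeR R) setT -%R.
  exact: measurable_funN.
have := @ge0_integral_pushforward _ _ _ _ R _ mN leb setT f measurableT mf
  (fun x _ => f0 x).
rewrite preimage_setT => <-.
by apply: eq_measure_integral => A mA _; rewrite -[RHS]lebesgue_measureN.
Qed.

Lemma normal_pdf_gt0 (a s x : R) : s != 0 -> 0 < normal_pdf a s x.
Proof. by move=> s0; rewrite normal_pdfE// mulr_gt0 ?normal_peak_gt0 ?expR_gt0. Qed.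

Lemma normal_pdfN s x : s != 0 -> normal_pdf 0 s (- x) = normal_pdf 0 s x.
Proof. by move=> s0; rewrite !normal_pdfE// /normal_fun !subr0 sqrrN. Qed.

Lemma normal_pdf_shift (a s x : R) : s != 0 ->
  normal_pdf a s x = normal_pdf 0 s (x - a).
Proof. by move=> s0; rewrite !normal_pdfE// /normal_fun subr0. Qed.

Lemma normal_prob_symmetric s f : s != 0 ->
  measurable_fun setT f -> (forall x, 0 <= f x)%E ->
  (\int[normal_prob 0 s]_x f (- x)%R = \int[normal_prob 0 s]_x f x)%E.
Proof.
move=> s0 mf f0; rewrite !ge0_integral_normal_prob//; last first.
  by apply: measurableT_comp => //; exact: measurable_funN.
have := @ge0_integral_lebesgueN (fun x => f x * (normal_pdf 0 s x)%:E)%E.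
move=> E; apply: esym; apply: etrans; first (apply: esym; apply: E).
- apply: emeasurable_funM => //.
  by apply/measurable_EFinP; exact: measurable_normal_pdf.
- by move=> x; rewrite mule_ge0// lee_fin normal_pdf_ge0.
- by apply: eq_integral => x _; rewrite normal_pdfN.
Qed.

(** Rescaling a centered Gaussian is a quadratic exponential tilt, which reduces the exponential
    moments below to the normalization of a density. *)
Lemma normal_pdf_change_sd s t x : 0 < s -> 0 < t ->
  normal_pdf 0 t x =
  s / t * expR ((s ^- 2 - t ^- 2) / 2 * x ^+ 2) * normal_pdf 0 s x.
Proof.
move=> s0 t0; rewrite !normal_pdfE ?gt_eqF// /normal_fun !subr0.
have -> : normal_peak t = s / t * normal_peak s.
  rewrite /normal_peak -!mulrnAr !(sqrtrM _ (sqr_ge0 _)) !sqrtr_sqr !gtr0_norm//.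
  rewrite !invfM; field.
  by rewrite !gt_eqF// sqrtr_gt0 mulrn_wgt0// pi_gt0.
rewrite -!mulrA; congr (_ * (_ * _)).
rewrite mulrCA; congr (_ * _); rewrite -expRD; congr expR.
by field; rewrite !gt_eqF.
Qed.

Lemma integral_normal_expR_sqr s t : 0 < s -> 0 < t ->
  (\int[normal_prob 0 s]_x
     (expR ((s ^- 2 - t ^- 2) / 2 * x ^+ 2))%:E = (t / s)%:E)%E.
Proof.
move=> s0 t0.
have me : @measurable_fun _ _ (measurableTypeR R) _ setT
    (fun x => (expR ((s ^- 2 - t ^- 2) / 2 * x ^+ 2))%:E).
  apply/measurable_EFinP; apply: measurableT_comp => //.
  by apply: measurable_funM => //; exact: measurable_funX.
rewrite ge0_integral_normal_prob//.
transitivity (\int[leb]_x ((t / s)%:E * (normal_pdf 0 t x)%:E))%E.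
  apply: eq_integral => x _; rewrite -!EFinM; congr EFin.
  rewrite (normal_pdf_change_sd x s0 t0).
  by field; rewrite !gt_eqF.
rewrite ge0_integralZl ?integral_normal_pdf ?mule1//.
- by apply/measurable_EFinP; exact: measurable_normal_pdf.
- by move=> x _; rewrite lee_fin normal_pdf_ge0.
- by rewrite lee_fin divr_ge0 ?ltW.
Qed.

(* The moment is squeezed by integrating [1 + u <= expR u] at
   [u = c * x ^+ 2], for small [c] of either sign. *)
Lemma integral_normal_sqr s : 0 < s ->
  (\int[normal_prob 0 s]_x (x ^+ 2)%:E = (s ^+ 2)%:E)%E.
Proof.
move=> s0; set V := (X in X = _).
have V0 : (0 <= V)%E by apply: integral_ge0 => x _; rewrite lee_fin sqr_ge0.
have mx2 : @measurable_fun _ _ (measurableTypeR R) _ setT (fun x => (x ^+ 2)%:E).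
  by apply/measurable_EFinP; exact: measurable_funX.
have me c : @measurable_fun _ _ (measurableTypeR R) _ setT
    (fun x => (expR (c * x ^+ 2))%:E).
  apply/measurable_EFinP; apply: measurableT_comp => //.
  by apply: measurable_funM => //; exact: measurable_funX.
pose c t := (s ^- 2 - t ^- 2) / 2.
(* For [s < t] the coefficient [c t] is nonnegative and [V] is bounded above. For [t < s], in [lo],
   the term in [c t] changes sides, so that only nonnegative extended reals occur. *)
have up t : s < t -> (1 + (c t)%:E * V <= (t / s)%:E)%E.
  move=> st; have t0 := lt_trans s0 st.
  have c0 : 0 <= c t.
    rewrite /c divr_ge0// subr_ge0 lef_pV2 ?posrE ?exprn_gt0//.
    by rewrite ler_pXn2r ?nnegrE ?ltW.
  rewrite -(integral_normal_expR_sqr s0 t0) -/(c t).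
  rewrite /V -ge0_integralZl//; last by move=> x _; rewrite lee_fin sqr_ge0.
  rewrite -[X in (X + _)%E](_ : \int[normal_prob 0 s]_x 1 = 1)%E; last first.
    by rewrite integral_cst//= mul1e probability_setT.
  rewrite -ge0_integralD//; last 2 first.
  - by move=> x _; rewrite mule_ge0// lee_fin ?sqr_ge0.
  - exact: measurable_funeM.
  apply: ge0_le_integral => //.
  - by move=> x _; rewrite adde_ge0// mule_ge0// lee_fin ?sqr_ge0.
  - by apply: emeasurable_funD => //; exact: measurable_funeM.
  - by move=> x _; rewrite -EFinM -EFinD lee_fin expR_ge1Dx.
have lo t : 0 < t -> t < s -> (1 <= (t / s)%:E + (- c t)%:E * V)%E.
  move=> t0 ts.
  have c0 : 0 <= - c t.
    rewrite /c -mulNr opprB divr_ge0// subr_ge0 lef_pV2 ?posrE ?exprn_gt0//.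
    by rewrite ler_pXn2r ?nnegrE ?ltW.
  rewrite -(integral_normal_expR_sqr s0 t0) -/(c t).
  rewrite /V -ge0_integralZl//; last by move=> x _; rewrite lee_fin sqr_ge0.
  rewrite -[X in (X <= _)%E](_ : \int[normal_prob 0 s]_x 1 = 1)%E; last first.
    by rewrite integral_cst//= mul1e probability_setT.
  rewrite -ge0_integralD//; last 2 first.
  - by move=> x _; rewrite mule_ge0// lee_fin ?sqr_ge0.
  - exact: measurable_funeM.
  apply: ge0_le_integral => //.
  - by apply: emeasurable_funD => //; exact: measurable_funeM.
  - move=> x _; rewrite -EFinM -EFinD lee_fin.
    by rewrite mulNr lerBrDr expR_ge1Dx.
have Vfin : V \is a fin_num.
  rewrite ge0_fin_numE// ltNge leye_eq; apply/negP => /eqP Voo.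
  (* Any [t > s] would do: [c t > 0] makes the left side of [up] infinite if [V] is. *)
  have /up : s < s + s by rewrite ltrDr.
  have c0 : 0 < c (s + s).
    rewrite /c divr_gt0// subr_gt0 ltf_pV2 ?posrE ?exprn_gt0// ?addr_gt0//.
    by rewrite ltr_pXn2r ?nnegrE ?addr_ge0 ?ltW// ltrDr.
  by rewrite Voo gt0_muley ?lte_fin//.
rewrite -(fineK Vfin); congr EFin.
set v := fine V.
have v0 : 0 <= v by rewrite fine_ge0.
have cE t : 0 < t -> c t = (t - s) * (t + s) / (2 * s ^+ 2 * t ^+ 2).
  by move=> t0; rewrite /c; field; rewrite !gt_eqF.
have up' t : s < t -> v <= t ^+ 2.
  move=> st; have t0 := lt_trans s0 st.
  have := up _ st; rewrite -(fineK Vfin) -/v -EFinM -EFinD lee_fin cE//.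
  rewrite -(ler_pM2r (_ : 0 < 2 * s ^+ 2 * t ^+ 2)); last first.
    by rewrite !mulr_gt0 ?exprn_gt0.
  rewrite (_ : (1 + _) * _ = 2 * s ^+ 2 * t ^+ 2 + (t - s) * (t + s) * v); last first.
    by field; rewrite !gt_eqF.
  rewrite (_ : t / s * _ = 2 * s * t ^+ 3); last by field; rewrite !gt_eqF.
  move=> h.
  (* After division by [t - s], the bound [(t + s) * v <= 2 * s * t ^+ 2] and [2 * s < t + s] give
     [v <= t ^+ 2]. *)
  have : (t - s) * ((t + s) * v) <= (t - s) * (2 * s * t ^+ 2) by nra.
  rewrite ler_pM2l ?subr_gt0// => {}h.
  rewrite -(ler_pM2l (_ : 0 < t + s)) ?addr_gt0//; nra.
have lo' t : 0 < t -> t < s -> t ^+ 2 <= v.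
  move=> t0 ts.
  have := lo _ t0 ts; rewrite -(fineK Vfin) -/v -EFinM -EFinD lee_fin cE//.
  rewrite -(ler_pM2r (_ : 0 < 2 * s ^+ 2 * t ^+ 2)); last first.
    by rewrite !mulr_gt0 ?exprn_gt0.
  rewrite (_ : (t / s + _) * _ = 2 * s * t ^+ 3 + (s - t) * (t + s) * v); last first.
    by field; rewrite !gt_eqF.
  move=> h.
  have : (s - t) * (2 * s * t ^+ 2) <= (s - t) * ((t + s) * v) by nra.
  rewrite ler_pM2l ?subr_gt0// => {}h.
  rewrite -(ler_pM2l (_ : 0 < t + s)) ?addr_gt0//; nra.
have vE : v = Num.sqrt v ^+ 2 by rewrite sqr_sqrtr.
have r0 : 0 <= Num.sqrt v by exact: sqrtr_ge0.
move: vE r0; set r := Num.sqrt v => vE r0.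
rewrite vE; congr (_ ^+ 2); apply/eqP; rewrite eq_le; apply/andP; split.
- rewrite leNgt; apply/negP => sr.
  (* The midpoint of [s] and [r] is an admissible [t] strictly closer to [s] than [r] is, which
     contradicts the bound; likewise below. *)
  have := up' ((s + r) / 2); rewrite vE => /(_ _)/wrap[]; first by lra.
  rewrite ler_pXn2r ?nnegrE//; lra.
- rewrite leNgt; apply/negP => rs.
  have := lo' ((s + r) / 2); rewrite vE => /(_ _ _)/wrap[]; [lra|lra|].
  rewrite ler_pXn2r ?nnegrE//; lra.
Qed.

(** By symmetry the integral equals that of [(a - c * x) ^+ 2]; in the sum of the two the cross
    terms cancel pointwise. *)
Lemma integral_normal_sqr_affine s a c : 0 < s ->
  (\int[normal_prob 0 s]_x ((a + c * x) ^+ 2)%:E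
   = (a ^+ 2 + c ^+ 2 * s ^+ 2)%:E)%E.
Proof.
move=> s0; set I := (X in X = _).
have mf b : @measurable_fun _ _ (measurableTypeR R) _ setT
    (fun x => ((a + b * x) ^+ 2)%:E).
  apply/measurable_EFinP; apply: measurable_funX; exact: measurable_funD.
have mx2 : @measurable_fun _ _ (measurableTypeR R) _ setT (fun x => (x ^+ 2)%:E).
  by apply/measurable_EFinP; exact: measurable_funX.
have IN : I = (\int[normal_prob 0 s]_x ((a - c * x) ^+ 2)%:E)%E.
  rewrite /I -[LHS]normal_prob_symmetric ?gt_eqF//.
    by apply: eq_integral => x _; rewrite mulrN.
  by move=> x; rewrite lee_fin sqr_ge0.
have II : (I + I = (2 * (a ^+ 2 + c ^+ 2 * s ^+ 2))%:E)%E.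
  have mfN : @measurable_fun _ _ (measurableTypeR R) _ setT
    (fun x => ((a - c * x) ^+ 2)%:E).
    by under eq_fun do rewrite -mulNr; exact: mf.
  rewrite [X in (_ + X)%E]IN /I -ge0_integralD//; last 2 first.
  - by move=> x _; rewrite lee_fin sqr_ge0.
  - by move=> x _; rewrite lee_fin sqr_ge0.
  transitivity (\int[normal_prob 0 s]_x
      ((2 * a ^+ 2)%:E + (2 * c ^+ 2)%:E * (x ^+ 2)%:E))%E.
    by apply: eq_integral => x _; rewrite -EFinM -!EFinD; congr EFin; ring.
  rewrite ge0_integralD//; last 3 first.
  - by move=> x _; rewrite lee_fin; apply: mulr_ge0; rewrite ?sqr_ge0.
  - move=> x _; rewrite lee_fin; apply: mulr_ge0; last exact: sqr_ge0.
    by apply: mulr_ge0 => //; exact: sqr_ge0.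
  - exact: measurable_funeM.
  rewrite integral_cst//= probability_setT mule1.
  rewrite ge0_integralZl//; last 2 first.
  - by move=> x _; rewrite lee_fin sqr_ge0.
  - by rewrite lee_fin; apply: mulr_ge0 => //; exact: sqr_ge0.
  by rewrite integral_normal_sqr// -EFinM -EFinD; congr EFin; ring.
have I0 : (0 <= I)%E by apply: integral_ge0 => x _; rewrite lee_fin sqr_ge0.
move: II I0; case: I {IN} => [r| |]//=.
by rewrite -EFinD => -[h] _; congr EFin; lra.
Qed.

End gaussian_integrals.

(** * Expectations expressed through the laws of source, noise and output *)

Lemma ge0_integral_gaussian (R : realType) (d : measure_display)
    (T : measurableType d) (P : probability T R) (X : {RV P >-> R}) (s : R)
    (F : measurableTypeR R -> \bar R) :
  (forall B : set R, measurable B -> distribution P X B = normal_prob 0 s B) ->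
  measurable_fun setT F -> (forall x, 0 <= F x)%E ->
  (\int[P]_t F (X t) = \int[normal_prob 0 s]_x F x)%E.
Proof.
move=> hX mF F0.
have mX : @measurable_fun _ _ T (measurableTypeR R) setT X.
  exact: (@measurable_funP _ _ T R setT X).
pose X' : {mfun T >-> measurableTypeR R} :=
  HB.pack (X : T -> measurableTypeR R)
    (isMeasurableFun.Build _ _ T (measurableTypeR R) _ mX).
rewrite -(@ge0_integral_distribution _ _ _ _ _ P X' F)//.
by apply: eq_measure_integral => A mA _; exact: hX.
Qed.

Section signaling_laws.
Context {R : realType} {d : measure_display} {T : measurableType d}.
Variables (P : probability T R) (m w : {RV P >-> R}) (sm sw : R).
Local Notation mR := (measurableTypeR R).
Local Notation leb := (@lebesgue_measure R).
Hypotheses (sm0 : 0 < sm) (sw0 : 0 < sw).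
Hypothesis hm : forall B : set R, measurable B ->
  distribution P m B = normal_prob 0 sm B.
Hypothesis hw : forall B : set R, measurable B ->
  distribution P w B = normal_prob 0 sw B.
Hypothesis hind : independent_RVs m w.

(** Independence fixes the law of the pair on rectangles, hence it is the product measure; Tonelli
    then iterates the integral. *)
Lemma ge0_integral_joint_law (F : mR * mR -> \bar R) :
  measurable_fun setT F -> (forall z, 0 <= F z)%E ->
  (\int[P]_t F (m t, w t)
   = \int[normal_prob 0 sm]_x \int[normal_prob 0 sw]_v F (x, v))%E.
Proof.
move=> mF F0.
have mX : @measurable_fun _ _ T (mR * mR)%type setT (fun t => (m t, w t)).
  by apply: (@measurable_fun_pair _ _ _ T mR mR);
    [exact: (@measurable_funP _ _ T R setT m)|exact: (@measurable_funP _ _ T R setT w)].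
pose X : {mfun T >-> (mR * mR)%type} :=
  HB.pack (fun t => (m t, w t) : (mR * mR)%type)
    (isMeasurableFun.Build _ _ T (mR * mR)%type _ mX).
rewrite -(@ge0_integral_distribution _ _ _ _ _ P X F)//.
rewrite -(@fubini_tonelli1 _ _ mR mR R (normal_prob 0 sm) (normal_prob 0 sw) F)//.
apply: eq_measure_integral => A mA _.
apply/esym/product_measure_unique => // B C mB mC.
transitivity (distribution P m B * distribution P w C)%E; first exact: hind.
by congr (_ * _)%E; [exact: hm|exact: hw].
Qed.

(** Given the source value [x], the output has density [normal_pdf (f x) sw]: translate the noise by
    [f x], then exchange the integrals. The output is left outermost, where a decoder can be
    optimized pointwise. *)
Lemma ge0_integral_output_law (f : {mfun R >-> R}) (F : mR * mR -> \bar R) :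
  measurable_fun setT F -> (forall z, 0 <= F z)%E ->
  (\int[P]_t F (m t, f (m t) + w t)%R
   = \int[leb]_y \int[normal_prob 0 sm]_x
       (F (x, y) * (normal_pdf (f x) sw y)%:E))%E.
Proof.
move=> mF F0.
have mf : @measurable_fun _ _ mR mR setT f.
  exact: (@measurable_funP _ _ R R setT f).
have msh : @measurable_fun _ _ (mR * mR)%type (mR * mR)%type setT
    (fun z => (z.1, f z.1 + z.2)).
  apply: (@measurable_fun_pair _ _ _ (mR * mR)%type mR mR) => //.
  apply: measurable_funD => //.
  by apply: measurableT_comp mf _.
have mpdf : @measurable_fun _ _ (mR * mR)%type _ setT
    (fun z => (normal_pdf (f z.1) sw z.2)%:E).
  apply/measurable_EFinP.
  under eq_fun do rewrite normal_pdf_shift ?gt_eqF//.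
  apply: measurableT_comp (measurable_normal_pdf 0 sw) _.
  apply: measurable_funB => //.
  by apply: measurableT_comp mf _.
have mFp : @measurable_fun _ _ (mR * mR)%type _ setT
    (fun z => (F z * (normal_pdf (f z.1) sw z.2)%:E)%E).
  exact: emeasurable_funM.
pose G z := F (z.1, f z.1 + z.2).
have mG : measurable_fun setT G by exact: measurableT_comp mF msh.
have G0 z : (0 <= G z)%E by exact: F0.
have Fp0 z : (0 <= F z * (normal_pdf (f z.1) sw z.2)%:E)%E.
  by apply: mule_ge0 => //; rewrite lee_fin normal_pdf_ge0.
apply: (etrans (ge0_integral_joint_law mG G0)).
apply: (etrans _ (@fubini_tonelli _ _ mR mR R (normal_prob 0 sm) leb _ mFp Fp0)).
apply: eq_integral => x _.
have mFx : @measurable_fun _ _ mR _ setT (fun y => F (x, y)).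
  exact: measurable_fun_pair2.
have mpx : @measurable_fun _ _ mR _ setT (fun y => (normal_pdf (f x) sw y)%:E).
  by apply/measurable_EFinP; exact: measurable_normal_pdf.
have mGx : @measurable_fun _ _ mR _ setT (fun v => G (x, v)).
  exact: measurable_fun_pair2.
have Gx0 v : (0 <= G (x, v))%E by exact: G0.
apply: (etrans (ge0_integral_normal_prob 0 sw mGx Gx0)).
pose H y := (F (x, y) * (normal_pdf (f x) sw y)%:E)%E.
have mH : @measurable_fun _ _ mR _ setT H by exact: emeasurable_funM.
have H0 y : (0 <= H y)%E by exact: (Fp0 (x, y)).
apply: (etrans _ (ge0_integral_lebesgueD (f x) mH H0)).
apply: eq_integral => v _; rewrite /G /H /=; congr (_ * _%:E)%E.
rewrite (normal_pdf_shift (f x) (f x + v)) ?gt_eqF//.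
by congr normal_pdf; rewrite addrAC subrr add0r.
Qed.

End signaling_laws.

(** * General facts about integrals and almost sure statements *)

Section integral_facts.
Local Open Scope ereal_scope.

Lemma ge0_integrable d (T : measurableType d) (R : realType)
    (mu : {measure set T -> \bar R}) (f : T -> \bar R) :
  measurable_fun setT f -> (forall t, 0 <= f t) -> \int[mu]_t f t < +oo ->
  mu.-integrable setT f.
Proof.
move=> mf f0 foo; apply/integrableP; split => //.
rewrite (_ : \int[mu]_t `|f t| = \int[mu]_t f t)//.
by apply: eq_integral => t _; rewrite gee0_abs.
Qed.

(* With [W] constant equal to [1] this is the bias-variance decomposition. *)
Lemma integral_sqr_subr_weighted d (T : measurableType d) (R : realType)
    (mu : {measure set T -> \bar R}) (Y W : T -> R) (c : R) :
  measurable_fun setT Y -> measurable_fun setT W -> (forall t, (0 <= W t)%R) ->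
  \int[mu]_t (W t)%:E < +oo -> \int[mu]_t (Y t ^+ 2 * W t)%:E < +oo ->
  \int[mu]_t ((Y t - c) ^+ 2 * W t)%:E =
  (fine (\int[mu]_t (Y t ^+ 2 * W t)%:E)
   - c * 2 * fine (\int[mu]_t (Y t * W t)%:E)
   + c ^+ 2 * fine (\int[mu]_t (W t)%:E))%:E.
Proof.
move=> mY mW W0 Woo Y2oo.
have mYW : measurable_fun setT (fun t => (Y t * W t)%:E).
  by apply/measurable_EFinP; exact: measurable_funM.
have mY2W : measurable_fun setT (fun t => (Y t ^+ 2 * W t)%:E).
  by apply/measurable_EFinP; apply: measurable_funM => //; exact: measurable_funX.
have mW' : measurable_fun setT (fun t => (W t)%:E) by exact/measurable_EFinP.
have iW : mu.-integrable setT (fun t => (W t)%:E).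
  by apply: ge0_integrable => // t; rewrite lee_fin.
have iY2W : mu.-integrable setT (fun t => (Y t ^+ 2 * W t)%:E).
  by apply: ge0_integrable => // t; rewrite lee_fin mulr_ge0 ?sqr_ge0.
(* Domination by [W + Y ^+ 2 * W], from [(a - 1) ^+ 2 >= 0] with [a] the absolute value of [Y t]. *)
have iYW : mu.-integrable setT (fun t => (Y t * W t)%:E).
  apply: (le_integrable measurableT mYW _ (integrableD measurableT iW iY2W)).
  - move=> t _ /=; rewrite lee_fin normrM (ger0_norm (W0 t)).
    rewrite [leRHS]ger0_norm; last first.
      by apply: addr_ge0 => //; apply: mulr_ge0 => //; exact: sqr_ge0.
    rewrite -{2}(mul1r (W t)) -mulrDl ler_wpM2r//.
    rewrite -(real_normK (num_real (Y t))); set a := `|Y t|%R.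
    by have := sqr_ge0 (a - 1)%R; nra.
transitivity (\int[mu]_t ((Y t ^+ 2 * W t)%:E +
    ((- (c * 2))%:E * (Y t * W t)%:E + (c ^+ 2)%:E * (W t)%:E))).
  by apply: eq_integral => t _; rewrite -!EFinM -!EFinD; congr EFin; ring.
rewrite integralD//; last by apply: integrableD => //; exact: integrableZl.
rewrite integralD//; [|exact: integrableZl..].
rewrite !integralZl//.
rewrite -(fineK (integrable_fin_num _ iW))// -(fineK (integrable_fin_num _ iYW))//.
rewrite -(fineK (integrable_fin_num _ iY2W))//.
by rewrite -!EFinM -!EFinD; congr EFin => /=; ring.
Qed.

(** Applies Tonelli measurability to the positive and negative parts; the signed case serves the
    numerator of the posterior mean. *)
Lemma measurable_fun_integral_param d1 d2 (T1 : measurableType d1)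
    (T2 : measurableType d2) (R : realType)
    (mu : {sigma_finite_measure set T1 -> \bar R}) (h : T1 * T2 -> \bar R) :
  measurable_fun setT h ->
  measurable_fun setT (fun y => \int[mu]_x h (x, y)).
Proof.
move=> mh; under eq_fun do rewrite integralE.
apply: emeasurable_funB.
- move: (measurable_fun_fubini_tonelli_G (m1 := mu) h^\+
    (measurable_funepos mh) (fun _ => funepos_ge0 _ _)).
  by rewrite /fubini_G !funepos.unlock.
- move: (measurable_fun_fubini_tonelli_G (m1 := mu) h^\-
    (measurable_funeneg mh) (fun _ => funeneg_ge0 _ _)).
  by rewrite /fubini_G !funeneg.unlock.
Qed.

Lemma probability_ae_exists d (T : measurableType d) (R : realType)
    (P : probability T R) (A : T -> Prop) :
  {ae P, forall t, A t} -> exists t, A t.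
Proof.
move=> [N [mN N0 AN]]; apply: contrapT => nA.
have : P setT <= P N.
  apply: le_measure; rewrite ?inE// => t _; apply: AN => /= At.
  by apply: nA; exists t.
by rewrite probability_setT N0 lee_fin ler10.
Qed.

Lemma probability_integral_gt0 d (T : measurableType d) (R : realType)
    (P : probability T R) (f : T -> \bar R) :
  measurable_fun setT f -> (forall t, 0 < f t) -> 0 < \int[P]_t f t.
Proof.
move=> mf f0; rewrite lt_neqAle integral_ge0 ?andbT; last by move=> t _; exact: ltW.
apply/eqP => If0.
have /(ae_eq_integral_abs P measurableT mf) : \int[P]_t `|f t| = 0.
  by rewrite If0; apply: eq_integral => t _; rewrite gee0_abs// ltW.
move=> /probability_ae_exists[t /(_ I) ft0].
by have := f0 t; rewrite ft0 ltxx.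
Qed.

End integral_facts.

(** * Existence of a best-responding decoder *)

Section mmse.
Context {R : realType} {d : measure_display} {T : measurableType d}.
Variables (P : probability T R) (m w : {RV P >-> R}) (sm sw : R).
Local Notation mR := (measurableTypeR R).
Local Notation leb := (@lebesgue_measure R).
Hypotheses (sm0 : 0 < sm) (sw0 : 0 < sw).
Hypothesis hm : forall B : set R, measurable B ->
  distribution P m B = normal_prob 0 sm B.
Hypothesis hw : forall B : set R, measurable B ->
  distribution P w B = normal_prob 0 sw B.
Hypothesis hind : independent_RVs m w.

Lemma decoder_cost_output_law (f g : policy R) :
  (decoder_cost m w f g =
   \int[leb]_y \int[normal_prob 0 sm]_x
     (((x - g y) ^+ 2 * normal_pdf (f x) sw y)%:E))%E.
Proof.
rewrite /decoder_cost expectation.unlock /channel_output.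
have mF : @measurable_fun _ _ (mR * mR)%type _ setT
    (fun z => ((z.1 - g z.2) ^+ 2)%:E).
  apply/measurable_EFinP; apply: measurable_funX; apply: measurable_funB => //.
  apply: (@measurableT_comp _ _ _ (mR * mR)%type mR R g) => //.
  exact: (@measurable_funP _ _ R R setT g).
have F0 (z : mR * mR) : (0 <= ((z.1 - g z.2) ^+ 2)%:E)%E.
  by rewrite lee_fin sqr_ge0.
exact: (ge0_integral_output_law sw0 hm hw hind f mF F0).
Qed.

(* Bayes' formula: for each [y], the posterior mean minimizes
   [c |-> \int (x - c) ^+ 2 * normal_pdf (f x) sw y] over the source law. *)
Lemma exists_best_response (f : policy R) :
  exists g : policy R, forall g' : policy R,
    (decoder_cost m w f g <= decoder_cost m w f g')%E.
Proof.
pose W y x := normal_pdf (f x) sw y.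
have W0 y x : 0 <= W y x by exact: normal_pdf_ge0.
have mf : @measurable_fun _ _ mR mR setT f.
  exact: (@measurable_funP _ _ R R setT f).
have mW2 : @measurable_fun _ _ (mR * mR)%type mR setT (fun z => W z.2 z.1).
  rewrite /W; under eq_fun do rewrite normal_pdf_shift ?gt_eqF//.
  apply: (@measurableT_comp _ _ _ (mR * mR)%type mR mR (normal_pdf 0 sw)).
    exact: measurable_normal_pdf.
  by apply: measurable_funB => //; apply: measurableT_comp mf _.
have mW y : @measurable_fun _ _ mR mR setT (W y).
  exact: (measurable_fun_pair1 y mW2).
pose I0 y := (\int[normal_prob 0 sm]_x (W y x)%:E)%E.
pose I1 y := (\int[normal_prob 0 sm]_x (x * W y x)%:E)%E.
have mI0 : @measurable_fun _ _ mR _ setT I0.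
  apply: (@measurable_fun_integral_param _ _ mR mR R (normal_prob 0 sm)
    (fun z => (W z.2 z.1)%:E)).
  exact/measurable_EFinP.
have mI1 : @measurable_fun _ _ mR _ setT I1.
  apply: (@measurable_fun_integral_param _ _ mR mR R (normal_prob 0 sm)
    (fun z => (z.1 * W z.2 z.1)%:E)).
  by apply/measurable_EFinP; exact: measurable_funM.
(* This uniform bound on the noise density makes the weighted moments of order 0 and 2 finite at
   every [y]. *)
have Wle y x : W y x <= normal_peak sw by apply: normal_pdf_ub; rewrite gt_eqF.
have I0oo y : (I0 y < +oo)%E.
  apply: (@le_lt_trans _ _ (\int[normal_prob 0 sm]_x (normal_peak sw)%:E)%E).
    apply: ge0_le_integral => //.
    - by move=> x _; rewrite lee_fin.
    - by apply/measurable_EFinP; exact: mW.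
    - by move=> x _; rewrite lee_fin.
  by rewrite integral_cst//= probability_setT mule1 ltry.
have I0gt y : (0 < I0 y)%E.
  apply: probability_integral_gt0; first by apply/measurable_EFinP; exact: mW.
  by move=> x; rewrite lte_fin normal_pdf_gt0 ?gt_eqF.
have I2oo y : (\int[normal_prob 0 sm]_x (x ^+ 2 * W y x)%:E < +oo)%E.
  apply: (@le_lt_trans _ _ (\int[normal_prob 0 sm]_x
    ((normal_peak sw)%:E * (x ^+ 2)%:E))%E).
    apply: ge0_le_integral => //.
    - by move=> x _; rewrite lee_fin mulr_ge0 ?sqr_ge0.
    - apply/measurable_EFinP; apply: measurable_funM; [exact: measurable_funX|exact: mW].
    - apply: measurable_funeM.
      by apply/measurable_EFinP; exact: measurable_funX.
    - by move=> x _; rewrite -EFinM lee_fin mulrC ler_wpM2r ?sqr_ge0.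
  rewrite ge0_integralZl//; last 3 first.
  - by apply/measurable_EFinP; exact: measurable_funX.
  - by move=> x _; rewrite lee_fin sqr_ge0.
  - by rewrite lee_fin normal_peak_ge0.
  by rewrite integral_normal_sqr// -EFinM ltry.
(* The posterior mean. The reciprocal is written as the power [-1], a measurable function; the two
   agree since [I0 y > 0]. *)
pose g0 (y : R) : R := fine (I1 y) * (fine (I0 y)) `^ (-1).
have mg0 : @measurable_fun _ _ mR R setT g0.
  have mfine (h : mR -> \bar R) : measurable_fun setT h ->
      @measurable_fun _ _ mR R setT (fun y => fine (h y)).
    by move=> mh; apply: (@measurableT_comp _ _ _ mR _ R fine) => //.
  apply: (@measurable_funM _ mR R setT (fun y => fine (I1 y))); first exact: mfine.
  apply: (@measurableT_comp _ _ _ mR R R (fun r => r `^ (-1))).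
    exact: measurable_powR.
  exact: mfine.
pose g : policy R := HB.pack g0 (isMeasurableFun.Build _ _ R R g0 mg0).
have postE (h : policy R) (y : R) :
  (\int[normal_prob 0 sm]_x (((x - h y) ^+ 2 * W y x)%:E) =
   (fine (\int[normal_prob 0 sm]_x (x ^+ 2 * W y x)%:E)
    - h y * 2 * fine (I1 y) + h y ^+ 2 * fine (I0 y))%:E)%E.
  have mid : @measurable_fun _ _ mR R setT idfun by exact: measurable_id.
  exact: (@integral_sqr_subr_weighted _ mR R (normal_prob 0 sm) idfun (W y) (h y)
    mid (mW y) (W0 y) (I0oo y) (I2oo y)).
have mpost (h : policy R) : @measurable_fun _ _ mR _ setT
    (fun y => \int[normal_prob 0 sm]_x (((x - h y) ^+ 2 * W y x)%:E))%E.
  apply: (@measurable_fun_integral_param _ _ mR mR R (normal_prob 0 sm)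
    (fun z => ((z.1 - h z.2) ^+ 2 * W z.2 z.1)%:E)).
  apply/measurable_EFinP; apply: measurable_funM => //.
  apply: measurable_funX; apply: measurable_funB => //.
  apply: (@measurableT_comp _ _ _ (mR * mR)%type mR R h) => //.
  exact: (@measurable_funP _ _ R R setT h).
exists g => g'; rewrite !decoder_cost_output_law.
apply: ge0_le_integral => //.
- move=> y _; apply: integral_ge0 => x _.
  by rewrite lee_fin mulr_ge0 ?sqr_ge0 ?normal_pdf_ge0.
move=> y _; rewrite (postE g) (postE g') lee_fin.
have a0 : 0 < fine (I0 y) by rewrite fine_gt0// I0gt I0oo.
have -> : g y = fine (I1 y) / fine (I0 y).
  by rewrite /g /= /g0 powR_inv1// ltW.
set c := g' y; move: a0; set a := fine (I0 y); set e := fine (I1 y) => a0.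
(* Completing the square: the excess posterior cost of the decision [c] is [a] times its squared
   distance to the posterior mean [e / a]. *)
rewrite -subr_ge0 (_ : _ - _ = a * (c - e / a) ^+ 2).
  by rewrite mulr_ge0 ?sqr_ge0 ?ltW.
by field; rewrite gt_eqF.
Qed.

End mmse.

(** * Divergence of the joint law from the Gaussian model *)

Section gap.
Context {R : realType} {d : measure_display} {T : measurableType d}.
Variables (P : probability T R) (m w : {RV P >-> R}) (sm sw sD sS : R).
Local Notation mR := (measurableTypeR R).
Local Notation leb := (@lebesgue_measure R).
Hypotheses (sm0 : 0 < sm) (sw0 : 0 < sw) (sD0 : 0 < sD) (sS0 : 0 < sS).
Hypothesis sDS : sD * sS = sm * sw.
Hypothesis hm : forall B : set R, measurable B ->
  distribution P m B = normal_prob 0 sm B.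
Hypothesis hw : forall B : set R, measurable B ->
  distribution P w B = normal_prob 0 sw B.
Hypothesis hind : independent_RVs m w.
Variables f g : policy R.

(* Half the logarithm of the density ratio between the Gaussian model (output
   of variance [sS ^+ 2], source of variance [sD ^+ 2] around the estimate) and
   the actual joint law of source and output. *)
Definition log_ratio (x y : R) : R :=
  (x ^+ 2 / sm ^+ 2 + (y - f x) ^+ 2 / sw ^+ 2
   - (x - g y) ^+ 2 / sD ^+ 2 - y ^+ 2 / sS ^+ 2) / 2.

Definition gap_fun (u : R) : R := expR u - (1 + u).

Lemma gap_fun_ge0 u : 0 <= gap_fun u.
Proof. by rewrite subr_ge0 expR_ge1Dx. Qed.

Lemma gap_fun_eq0 u : gap_fun u = 0 -> u = 0.
Proof.
move=> /eqP; rewrite subr_eq0 => /eqP h; apply/eqP/negP => /negP /expR_gt1Dx.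
by rewrite h ltxx.
Qed.

Let mf : @measurable_fun _ _ mR mR setT f.
Proof. exact: (@measurable_funP _ _ R R setT f). Qed.

Let mg : @measurable_fun _ _ mR mR setT g.
Proof. exact: (@measurable_funP _ _ R R setT g). Qed.

Let mf1 : @measurable_fun _ _ (mR * mR)%type R setT (fun z => f z.1).
Proof. by apply: measurableT_comp mf _. Qed.

Let mg2 : @measurable_fun _ _ (mR * mR)%type R setT (fun z => g z.2).
Proof. by apply: measurableT_comp mg _. Qed.

Lemma measurable_log_ratio :
  @measurable_fun _ _ (mR * mR)%type R setT (fun z => log_ratio z.1 z.2).
Proof.
apply: measurable_funM => //; apply: measurable_funB; last first.
  by apply: measurable_funM => //; exact: measurable_funX.
apply: measurable_funB; last first.
  apply: measurable_funM => //; apply: measurable_funX.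
  exact: measurable_funB.
apply: measurable_funD.
  by apply: measurable_funM => //; exact: measurable_funX.
apply: measurable_funM => //; apply: measurable_funX.
exact: measurable_funB.
Qed.

(** The quadratic exponents match by the choice of [log_ratio], the normalizing constants by
    [sDS]. *)
Lemma expR_log_ratioM x y :
  expR (log_ratio x y) * normal_pdf (f x) sw y * normal_pdf 0 sm x =
  normal_pdf (g y) sD x * normal_pdf 0 sS y.
Proof.
have peakE s : 0 < s -> normal_peak s = s^-1 * (Num.sqrt (pi *+ 2))^-1.
  move=> s0; rewrite /normal_peak -mulrnAr (sqrtrM _ (sqr_ge0 _)) sqrtr_sqr.
  by rewrite gtr0_norm// invfM.
rewrite !normal_pdfE ?gt_eqF// /normal_fun !subr0 !peakE//.
set k := (Num.sqrt _)^-1.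
transitivity ((sm * sw)^-1 * k ^+ 2 *
  (expR (log_ratio x y) * expR (- (y - f x) ^+ 2 / (sw ^+ 2 *+ 2))
   * expR (- x ^+ 2 / (sm ^+ 2 *+ 2)))).
  by rewrite invfM; ring.
transitivity ((sD * sS)^-1 * k ^+ 2 *
  (expR (- (x - g y) ^+ 2 / (sD ^+ 2 *+ 2)) * expR (- y ^+ 2 / (sS ^+ 2 *+ 2)))).
  rewrite sDS -!expRD; congr (_ * expR _); rewrite /log_ratio.
  by field; rewrite !gt_eqF.
by rewrite invfM; ring.
Qed.

(** The expectation turns into the total mass of the model density, integrated first over the source
    around [g y], then over the output. *)
Lemma integral_expR_log_ratio :
  (\int[P]_t (expR (log_ratio (m t) (f (m t) + w t)))%:E = 1)%E.
Proof.
have mF : @measurable_fun _ _ (mR * mR)%type _ setT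
    (fun z => (expR (log_ratio z.1 z.2))%:E).
  apply/measurable_EFinP; apply: measurableT_comp => //.
  exact: measurable_log_ratio.
have F0 (z : mR * mR) : (0 <= (expR (log_ratio z.1 z.2))%:E)%E.
  by rewrite lee_fin expR_ge0.
apply: (etrans (ge0_integral_output_law sw0 hm hw hind f mF F0)).
rewrite -(integral_normal_pdf 0 sS); apply: eq_integral => y _.
have mFy : @measurable_fun _ _ mR _ setT (fun x =>
    (expR (log_ratio x y))%:E * (normal_pdf (f x) sw y)%:E)%E.
  apply: emeasurable_funM; first exact: (measurable_fun_pair1 y mF).
  apply/measurable_EFinP.
  under eq_fun do rewrite normal_pdf_shift ?gt_eqF//.
  apply: (@measurableT_comp _ _ _ mR mR mR (normal_pdf 0 sw)).
    exact: measurable_normal_pdf.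
  exact: measurable_funB.
have Fy0 x : (0 <= (expR (log_ratio x y))%:E * (normal_pdf (f x) sw y)%:E)%E.
  by rewrite -EFinM lee_fin mulr_ge0 ?expR_ge0 ?normal_pdf_ge0.
apply: (etrans (ge0_integral_normal_prob 0 sm mFy Fy0)).
transitivity (\int[leb]_x
    ((normal_pdf 0 sS y)%:E * (normal_pdf (g y) sD x)%:E))%E.
  apply: eq_integral => x _; rewrite -!EFinM expR_log_ratioM.
  by rewrite mulrC.
rewrite ge0_integralZl//.
- by rewrite integral_normal_pdf mule1.
- by apply/measurable_EFinP; exact: measurable_normal_pdf.
- by move=> x _; rewrite lee_fin normal_pdf_ge0.
- by rewrite lee_fin normal_pdf_ge0.
Qed.

Lemma integral_source_sqr : (\int[P]_t (m t ^+ 2)%:E = (sm ^+ 2)%:E)%E.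
Proof.
have mx2 : @measurable_fun _ _ mR _ setT (fun x => (x ^+ 2)%:E).
  by apply/measurable_EFinP; exact: measurable_funX.
have x20 (x : mR) : (0 <= (x ^+ 2)%:E)%E by rewrite lee_fin sqr_ge0.
by rewrite (ge0_integral_gaussian hm mx2 x20) integral_normal_sqr.
Qed.

Lemma integral_noise_sqr : (\int[P]_t (w t ^+ 2)%:E = (sw ^+ 2)%:E)%E.
Proof.
have mx2 : @measurable_fun _ _ mR _ setT (fun x => (x ^+ 2)%:E).
  by apply/measurable_EFinP; exact: measurable_funX.
have x20 (x : mR) : (0 <= (x ^+ 2)%:E)%E by rewrite lee_fin sqr_ge0.
by rewrite (ge0_integral_gaussian hw mx2 x20) integral_normal_sqr.
Qed.

(** For a fixed source value the noise is centered, so the cross term vanishes in the inner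
    integral; an infinite power is covered as well. *)
Lemma integral_output_sqr :
  (\int[P]_t ((f (m t) + w t) ^+ 2)%:E =
   \int[P]_t (f (m t) ^+ 2)%:E + (sw ^+ 2)%:E)%E.
Proof.
have mF : @measurable_fun _ _ (mR * mR)%type _ setT
    (fun z => ((f z.1 + z.2) ^+ 2)%:E).
  by apply/measurable_EFinP; apply: measurable_funX; exact: measurable_funD.
have F0 (z : mR * mR) : (0 <= ((f z.1 + z.2) ^+ 2)%:E)%E.
  by rewrite lee_fin sqr_ge0.
apply: (etrans (ge0_integral_joint_law hm hw hind mF F0)).
have mf2 : @measurable_fun _ _ mR _ setT (fun x => (f x ^+ 2)%:E).
  by apply/measurable_EFinP; exact: measurable_funX.
have f20 (x : mR) : (0 <= (f x ^+ 2)%:E)%E by rewrite lee_fin sqr_ge0.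
rewrite (ge0_integral_gaussian hm mf2 f20).
rewrite -[X in (_ + X)%E](_ : \int[normal_prob 0 sm]_x (sw ^+ 2)%:E = _)%E; last first.
  by rewrite integral_cst//= probability_setT mule1.
rewrite -ge0_integralD//; last by move=> x _; rewrite lee_fin sqr_ge0.
apply: eq_integral => x _ /=.
rewrite -EFinD -[in RHS](mul1r (sw ^+ 2)) -(expr1n _ 2).
rewrite -(integral_normal_sqr_affine (f x) 1 sw0).
by apply: eq_integral => v _; rewrite mul1r.
Qed.

(** In effect the Kullback-Leibler divergence of the actual joint law from the model. The extra
    [expR u - 1] has mean zero and makes the integrand nonnegative, so the value exists in [\bar R]
    for all policies. *)
Definition gap : \bar R :=
  (\int[P]_t (gap_fun (log_ratio (m t) (f (m t) + w t)))%:E)%E.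

Lemma gap_ge0 : (0 <= gap)%E.
Proof. by apply: integral_ge0 => t _; rewrite lee_fin gap_fun_ge0. Qed.

Lemma gapE :
  (gap + 1 = ((sD ^+ 2 *+ 2)^-1)%:E * decoder_cost m w f g
   + ((sS ^+ 2 *+ 2)^-1)%:E * (\int[P]_t (f (m t) ^+ 2)%:E + (sw ^+ 2)%:E))%E.
Proof.
rewrite -integral_output_sqr /decoder_cost expectation.unlock /channel_output.
have mm : measurable_fun setT (m : T -> R) := @measurable_funP _ _ T R setT m.
have mw : measurable_fun setT (w : T -> R) := @measurable_funP _ _ T R setT w.
have mfm : measurable_fun setT (fun t => f (m t)) by apply: measurableT_comp.
have my : measurable_fun setT (fun t => f (m t) + w t) by exact: measurable_funD.
have mgy : measurable_fun setT (fun t => g (f (m t) + w t)).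
  by apply: measurableT_comp.
have mL : @measurable_fun _ _ T R setT (fun t => log_ratio (m t) (f (m t) + w t)).
  have mp : @measurable_fun _ _ T (mR * mR)%type setT (fun t => (m t, f (m t) + w t)).
    exact: (@measurable_fun_pair _ _ _ T mR mR).
  exact: (measurableT_comp measurable_log_ratio mp).
have mG : measurable_fun setT
    (fun t => (gap_fun (log_ratio (m t) (f (m t) + w t)))%:E).
  apply/measurable_EFinP; apply: measurable_funB.
    by apply: measurableT_comp.
  exact: measurable_funD.
have mE : measurable_fun setT
    (fun t => (expR (log_ratio (m t) (f (m t) + w t)))%:E).
  by apply/measurable_EFinP; apply: measurableT_comp.
have mx2 (X : T -> R) : measurable_fun setT X ->
    measurable_fun setT (fun t => (X t ^+ 2)%:E).
  by move=> mX; apply/measurable_EFinP; exact: measurable_funX.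
have md : measurable_fun setT (fun t => m t - g (f (m t) + w t)).
  exact: measurable_funB.
have c0 (s : R) : (0 <= (s ^+ 2 *+ 2)^-1)%R by rewrite invr_ge0 mulrn_wge0 ?sqr_ge0.
pose c s : \bar R := ((s ^+ 2 *+ 2)^-1)%:E.
have c0' s : (0 <= c s)%E by rewrite lee_fin.
have sq0 (X : T -> R) : forall t, (0 <= (X t ^+ 2)%:E)%E.
  by move=> t; rewrite lee_fin sqr_ge0.
have csq0 (s : R) (X : T -> R) t : (0 <= c s * (X t ^+ 2)%:E)%E.
  by apply: mule_ge0.
have mc s (X : T -> R) : measurable_fun setT X ->
    measurable_fun setT (fun t => c s * (X t ^+ 2)%:E)%E.
  by move=> mX; apply: measurable_funeM; exact: mx2.
have cint s (X : T -> R) : measurable_fun setT X ->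
    (\int[P]_t (c s * (X t ^+ 2)%:E) = c s * \int[P]_t (X t ^+ 2)%:E)%E.
  by move=> mX; rewrite ge0_integralZl//; exact: mx2.
(* The definition of [log_ratio] rearranged so that both sides are sums of nonnegative terms, since
   the decoder cost and the power may be infinite. *)
have E : (gap + \int[P]_t (1 + (c sm * (m t ^+ 2)%:E + c sw * (w t ^+ 2)%:E)) =
   \int[P]_t ((expR (log_ratio (m t) (f (m t) + w t)))%:E
    + (c sD * ((m t - g (f (m t) + w t)) ^+ 2)%:E
       + c sS * ((f (m t) + w t) ^+ 2)%:E)))%E.
  rewrite /gap -ge0_integralD//; last 3 first.
  - by move=> t _; rewrite lee_fin gap_fun_ge0.
  - by move=> t _; apply: adde_ge0 => //; apply: adde_ge0.
  - by apply: emeasurable_funD => //; apply: emeasurable_funD; exact: mc.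
  apply: eq_integral => t _; rewrite /c -!EFinM -!EFinD; congr EFin.
  rewrite /gap_fun /log_ratio; set e := expR _.
  by field; rewrite !gt_eqF.
(* The normalized source and noise moments contribute [1 / 2] each. *)
have EL : (\int[P]_t (1 + (c sm * (m t ^+ 2)%:E + c sw * (w t ^+ 2)%:E)) = 2%:E)%E.
  rewrite ge0_integralD//; last 2 first.
  - by move=> t _; apply: adde_ge0.
  - by apply: emeasurable_funD; exact: mc.
  rewrite integral_cst//= mul1e probability_setT.
  rewrite ge0_integralD//; [|exact: mc..].
  rewrite !cint// integral_source_sqr integral_noise_sqr /c -!EFinM -!EFinD.
  by congr EFin; field; rewrite !gt_eqF.
move: E; rewrite EL.
rewrite ge0_integralD//; last 2 first.
- by move=> t _; apply: adde_ge0; apply: mule_ge0 => //; rewrite lee_fin sqr_ge0.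
- by apply: emeasurable_funD; exact: mc.
rewrite integral_expR_log_ratio ge0_integralD//; last 4 first.
- by move=> t _; apply: mule_ge0 => //; rewrite lee_fin sqr_ge0.
- by apply: mc; exact: measurable_funB.
- by move=> t _; apply: mule_ge0 => //; rewrite lee_fin sqr_ge0.
- exact: mc.
rewrite !cint//.
rewrite -/(c sD) -/(c sS); set X := (c sD * _ + _)%E.
have X0 : (0 <= X)%E.
  apply: adde_ge0; apply: mule_ge0 => //; apply: integral_ge0 => t _;
    by rewrite lee_fin sqr_ge0.
move=> E; have : (gap + 1 + 1 = X + 1)%E.
  by rewrite -addeA -EFinD E addeC.
by move=> /(congr1 (fun z => z - 1)%E); rewrite !addeK.
Qed.

(** A nonnegative integrand of integral zero vanishes almost everywhere. As the noise density is
    positive everywhere, the conclusion holds for Lebesgue-almost every output, whatever the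
    encoder. *)
Lemma gap_eq0_log_ratio : gap = 0%E ->
  {ae leb, forall y, {ae normal_prob 0 sm, forall x, log_ratio x y = 0}}.
Proof.
have mF : @measurable_fun _ _ (mR * mR)%type _ setT
    (fun z => (gap_fun (log_ratio z.1 z.2))%:E).
  apply/measurable_EFinP; apply: measurable_funB.
    by apply: measurableT_comp => //; exact: measurable_log_ratio.
  by apply: measurable_funD => //; exact: measurable_log_ratio.
have F0 (z : mR * mR) : (0 <= (gap_fun (log_ratio z.1 z.2))%:E)%E.
  by rewrite lee_fin gap_fun_ge0.
have mW2 : @measurable_fun _ _ (mR * mR)%type mR setT
    (fun z => normal_pdf (f z.1) sw z.2).
  under eq_fun do rewrite normal_pdf_shift ?gt_eqF//.
  apply: (@measurableT_comp _ _ _ (mR * mR)%type mR mR (normal_pdf 0 sw)).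
    exact: measurable_normal_pdf.
  exact: measurable_funB.
pose h z := ((gap_fun (log_ratio z.1 z.2))%:E * (normal_pdf (f z.1) sw z.2)%:E)%E.
have mh : @measurable_fun _ _ (mR * mR)%type _ setT h.
  by apply: emeasurable_funM => //; exact/measurable_EFinP.
have h0 z : (0 <= h z)%E.
  by rewrite /h -EFinM lee_fin mulr_ge0 ?gap_fun_ge0 ?normal_pdf_ge0.
move=> gap0.
have hgap : (\int[leb]_y \int[normal_prob 0 sm]_x h (x, y) = 0)%E.
  rewrite -gap0; apply: esym.
  exact: (ge0_integral_output_law sw0 hm hw hind f mF F0).
have mI : @measurable_fun _ _ mR _ setT
    (fun y => \int[normal_prob 0 sm]_x h (x, y))%E.
  exact: (@measurable_fun_integral_param _ _ mR mR R (normal_prob 0 sm) h).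
have I0 y : (0 <= \int[normal_prob 0 sm]_x h (x, y))%E.
  by apply: integral_ge0 => x _.
have /(ae_eq_integral_abs leb measurableT mI) :
    (\int[leb]_y `|\int[normal_prob 0 sm]_x h (x, y)| = 0)%E.
  by rewrite -hgap; apply: eq_integral => y _; rewrite gee0_abs.
apply: filterS => y /(_ I) /= hy.
have mhy : @measurable_fun _ _ mR _ setT (fun x => h (x, y)).
  exact: (measurable_fun_pair1 y mh).
have /(ae_eq_integral_abs (normal_prob 0 sm) measurableT mhy) :
    (\int[normal_prob 0 sm]_x `|h (x, y)| = 0)%E.
  by rewrite -hy; apply: eq_integral => x _; rewrite gee0_abs.
apply: filterS => x /(_ I) /=; rewrite /h /= -EFinM => -[] /eqP.
rewrite mulf_eq0 => /orP[/eqP /gap_fun_eq0//|/eqP p0].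
by have := normal_pdf_gt0 (f x) y (lt0r_neq0 sw0); rewrite p0 ltxx.
Qed.

End gap.

(** * Equality case: a vanishing log ratio forces linear policies *)

Section ae_combinators.
Context d (T : measurableType d) (R : realType) (mu : {measure set T -> \bar R}).
Implicit Types A B : T -> Prop.

Lemma ae_conj A B : {ae mu, forall t, A t} -> {ae mu, forall t, B t} ->
  {ae mu, forall t, A t /\ B t}.
Proof. by move=> hA hB; apply: filterI. Qed.

Lemma ae_mono A B : (forall t, A t -> B t) ->
  {ae mu, forall t, A t} -> {ae mu, forall t, B t}.
Proof. by move=> AB; apply: filterS. Qed.

End ae_combinators.

Section rigidity.
Context {R : realType}.
Local Notation mR := (measurableTypeR R).
Local Notation leb := (@lebesgue_measure R).

Lemma ae_normal_prob (a s : R) (A : mR -> Prop) :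
  {ae leb, forall x, A x} -> {ae normal_prob a s, forall x, A x}.
Proof.
move=> [N [mN N0 AN]]; exists N; split => //.
exact: (null_content_dominatesP _ _).1 (normal_prob_dominates a s) N mN N0.
Qed.

Lemma ae_lebesgue_neq (c : R) : {ae leb, forall x, x <> c}.
Proof.
exists [set c]; split => //; first exact: lebesgue_measure_set1.
by move=> x /= /contrapT.
Qed.

(** Points are null, so witnesses can be drawn one after another; three of them determine a
    quadratic polynomial. *)
Lemma ae_normal_exists3 (s : R) (A : mR -> Prop) :
  {ae normal_prob 0 s, forall x, A x} -> exists x0 x1 x2 : R,
    [/\ A x0, A x1 & A x2] /\ [/\ x0 <> x1, x0 <> x2 & x1 <> x2].
Proof.
move=> hA.
have [x0 A0] := probability_ae_exists hA.
have h1 : {ae normal_prob 0 s, forall x, A x /\ x <> x0}.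
  by apply: ae_conj => //; exact: ae_normal_prob (ae_lebesgue_neq x0).
have [x1 [A1 x10]] := probability_ae_exists h1.
have h2 : {ae normal_prob 0 s, forall x, (A x /\ x <> x0) /\ x <> x1}.
  by apply: ae_conj => //; exact: ae_normal_prob (ae_lebesgue_neq x1).
have [x2 [[A2 x20] x21]] := probability_ae_exists h2.
exists x0, x1, x2; split=> //; split=> // /esym; by [].
Qed.

(** Divided differences eliminate [c], then [b]. *)
Lemma quadratic_eq0 (a b c x0 x1 x2 : R) :
  x0 <> x1 -> x0 <> x2 -> x1 <> x2 ->
  a * x0 ^+ 2 + b * x0 + c = 0 -> a * x1 ^+ 2 + b * x1 + c = 0 ->
  a * x2 ^+ 2 + b * x2 + c = 0 -> [/\ a = 0, b = 0 & c = 0].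
Proof.
move=> /eqP; rewrite -subr_eq0 => x01 /eqP; rewrite -subr_eq0 => x02 /eqP.
rewrite -subr_eq0 => x12 e0 e1 e2.
have e01 : a * (x0 + x1) + b = 0.
  by apply: (mulfI x01); rewrite mulr0 -[RHS](subrr 0) -{1}e0 -e1; ring.
have e02 : a * (x0 + x2) + b = 0.
  by apply: (mulfI x02); rewrite mulr0 -[RHS](subrr 0) -{1}e0 -e2; ring.
have a0 : a = 0.
  by apply: (mulfI x12); rewrite mulr0 -[RHS](subrr 0) -{1}e01 -e02; ring.
have b0 : b = 0 by move: e01; rewrite a0; lra.
by split=> //; move: e0; rewrite a0 b0; lra.
Qed.

(* Two outputs [y1 <> y2] make [f] affine; comparing coefficients in [x] then
   makes [g] affine and kills the offset. *)
Lemma log_ratio_eq0_linear (sm sw sD sS : R) (f g : policy R) :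
  0 < sm -> 0 < sw -> 0 < sD -> 0 < sS -> sD * sS = sm * sw ->
  {ae leb, forall y, {ae normal_prob 0 sm, forall x,
     log_ratio sm sw sD sS f g x y = 0}} ->
  exists A K : R, {ae normal_prob 0 sm, forall x, f x = A * x} /\
    {ae leb, forall y, g y = K * y}.
Proof.
move=> sm0 sw0 sD0 sS0 sDS h.
(* The standard normal law only serves to draw two distinct good outputs from a Lebesgue-full
   set. *)
have [y1 [y2 [_ [[h1 h2 _] [y12 _ _]]]]] := ae_normal_exists3 (ae_normal_prob 0 1 h).
have {}y12 : y1 - y2 != 0 by apply/eqP => /eqP; rewrite subr_eq0 => /eqP.
(* In the difference of [log_ratio] at [y1] and [y2] the squares of [x] and [f x] cancel; [a] and
   [b] solve the remaining equation, linear in [f x]. *)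
pose a := sw ^+ 2 * (g y1 - g y2) / (sD ^+ 2 * (y1 - y2)).
pose b := sw ^+ 2 * (y1 ^+ 2 / sw ^+ 2 - y2 ^+ 2 / sw ^+ 2
  - g y1 ^+ 2 / sD ^+ 2 + g y2 ^+ 2 / sD ^+ 2
  - y1 ^+ 2 / sS ^+ 2 + y2 ^+ 2 / sS ^+ 2) / (2 * (y1 - y2)).
have hf : {ae normal_prob 0 sm, forall x, f x = a * x + b}.
  have h12 : {ae normal_prob 0 sm, forall x, log_ratio sm sw sD sS f g x y1 = 0
      /\ log_ratio sm sw sD sS f g x y2 = 0}.
    by apply: ae_conj; [exact: h1|exact: h2].
  move: h12; apply: ae_mono => x [e1 e2]; rewrite /a /b.
  apply/eqP; rewrite -subr_eq0.
  rewrite (_ : _ - _ = - (sw ^+ 2 / (y1 - y2)) * (log_ratio sm sw sD sS f g x y1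
    - log_ratio sm sw sD sS f g x y2)); last first.
    by rewrite /log_ratio; field; rewrite y12 !gt_eqF.
  by rewrite e1 e2 subrr mulr0.
clearbody a b.
have hg : {ae leb, forall y, g y = sD ^+ 2 * a / sw ^+ 2 * (y - b) /\
    (y - b) ^+ 2 = y ^+ 2}.
  move: h; apply: ae_mono => y hy.
  have hfy : {ae normal_prob 0 sm, forall x,
      f x = a * x + b /\ log_ratio sm sw sD sS f g x y = 0} by apply: ae_conj.
  have [x0 [x1 [x2 [[e0 e1 e2] [x01 x02 x12]]]]] := ae_normal_exists3 hfy.
  (* Coefficients in [x] of twice [log_ratio], once [f x] is replaced by [a * x + b]. *)
  pose c2 := (sm ^+ 2)^-1 + a ^+ 2 / sw ^+ 2 - (sD ^+ 2)^-1.
  pose c1 := 2 * (g y / sD ^+ 2 - a * (y - b) / sw ^+ 2).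
  pose c0 := (y - b) ^+ 2 / sw ^+ 2 - g y ^+ 2 / sD ^+ 2 - y ^+ 2 / sS ^+ 2.
  have poly x : f x = a * x + b /\ log_ratio sm sw sD sS f g x y = 0 ->
      c2 * x ^+ 2 + c1 * x + c0 = 0.
    move=> [fx]; rewrite /log_ratio fx => e.
    rewrite -[RHS](mulr0 2) -e /c2 /c1 /c0.
    by field; rewrite !gt_eqF.
  have [c20 c10 c00] := quadratic_eq0 x01 x02 x12 (poly _ e0) (poly _ e1) (poly _ e2).
  have gy : g y = sD ^+ 2 * a / sw ^+ 2 * (y - b).
    apply/eqP; rewrite -subr_eq0; apply/eqP.
    transitivity (sD ^+ 2 / 2 * c1); last by rewrite c10 mulr0.
    by rewrite /c1; field; rewrite !gt_eqF.
  split=> //.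
  apply/eqP; rewrite -subr_eq0; apply/eqP.
  have smE : sm = sD * sS / sw by rewrite sDS mulfK// gt_eqF.
  (* With [g y] substituted, this combination eliminates [a], and [sDS] reduces it to
     [(y - b) ^+ 2 - y ^+ 2]. *)
  transitivity (sS ^+ 2 * (c0 + (y - b) ^+ 2 / sw ^+ 2 * sD ^+ 2 * c2)).
    by rewrite /c0 /c2 gy smE; field; rewrite !gt_eqF.
  by rewrite c00 c20 mulr0 addr0 mulr0.
have b0 : b = 0.
  have [z1 [z2 [_ [[[_ e1] [_ e2] _] [z12 _ _]]]]] :=
    ae_normal_exists3 (ae_normal_prob 0 1 hg).
  (* Both points satisfy [b ^+ 2 = 2 * b * z]; subtract. *)
  have : b * (z1 - z2) = 0 by nra.
  move/eqP; rewrite mulf_eq0 subr_eq0 => /orP[/eqP//|/eqP].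
  by move=> /z12.
exists a, (sD ^+ 2 * a / sw ^+ 2); split.
- by move: hf; apply: ae_mono => x; rewrite b0 addr0.
- by move: hg; apply: ae_mono => y [+ _]; rewrite b0 subr0.
Qed.

End rigidity.

(** * Optimal cost, linear pair and equilibria *)

Section equilibria.
Context {R : realType} {d : measure_display} {T : measurableType d}.
Variables (P : probability T R) (m w : {RV P >-> R}) (vm vw b lambda : R).
Local Notation mR := (measurableTypeR R).
Local Notation leb := (@lebesgue_measure R).
Hypotheses (vm0 : 0 < vm) (vw0 : 0 < vw) (lambda0 : 0 < lambda).
Hypotheses (hm : centered_gaussian m vm) (hw : centered_gaussian w vw).
Hypothesis hind : independent_RVs m w.

Local Notation sm := (Num.sqrt vm).
Local Notation sw := (Num.sqrt vw).

Let sm0 : 0 < sm. Proof. by rewrite sqrtr_gt0. Qed.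
Let sw0 : 0 < sw. Proof. by rewrite sqrtr_gt0. Qed.
Let sm2 : sm ^+ 2 = vm. Proof. by rewrite sqr_sqrtr// ltW. Qed.
Let sw2 : sw ^+ 2 = vw. Proof. by rewrite sqr_sqrtr// ltW. Qed.

Lemma policy_of_fun (h : R -> R) : measurable_fun setT h ->
  {g : policy R | forall x, g x = h x}.
Proof.
move=> mh; pose g : policy R := HB.pack h (isMeasurableFun.Build _ _ R R h mh).
by exists g.
Qed.

Lemma linear_policy_of (A : R) : {g : policy R | forall x, g x = A * x}.
Proof. by apply: policy_of_fun; exact: mulrl_measurable. Qed.

Definition best_response (f g : policy R) : Prop :=
  forall g' : policy R, (decoder_cost m w f g <= decoder_cost m w f g')%E.

Definition power (f : policy R) : \bar R := (\int[P]_t (f (m t) ^+ 2)%:E)%E.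

Lemma decoder_cost_ge0 f g : (0 <= decoder_cost m w f g)%E.
Proof.
rewrite /decoder_cost expectation.unlock; apply: integral_ge0 => t _.
by rewrite lee_fin sqr_ge0.
Qed.

Lemma power_ge0 f : (0 <= power f)%E.
Proof. by apply: integral_ge0 => t _; rewrite lee_fin sqr_ge0. Qed.

Let measurable_output (f : policy R) : measurable_fun setT (channel_output m w f).
Proof.
apply: measurable_funD; last exact: (@measurable_funP _ _ T R setT w).
by apply: measurableT_comp; exact: measurable_funP.
Qed.

Let measurable_error (f g : policy R) :
  measurable_fun setT (fun t => m t - g (channel_output m w f t)).
Proof.
apply: measurable_funB; first exact: (@measurable_funP _ _ T R setT m).
apply: measurableT_comp; first exact: (@measurable_funP _ _ R R setT g).
exact: measurable_output.
Qed.

(* A best response leaves an error of mean zero, as it could otherwise be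
   improved by a constant; hence the bias [b] only contributes [b ^+ 2]. *)
Lemma encoder_cost_best_response f g : best_response f g ->
  (encoder_cost m w b lambda f g =
   decoder_cost m w f g + (b ^+ 2)%:E + lambda%:E * power f)%E.
Proof.
move=> fg; pose Y t := m t - g (channel_output m w f t).
have mY : measurable_fun setT Y by exact: measurable_error.
have DcE : decoder_cost m w f g = (\int[P]_t (Y t ^+ 2 * 1)%:E)%E.
  rewrite /decoder_cost expectation.unlock.
  by apply: eq_integral => t _; rewrite mulr1.
(* A best response does at least as well as the zero decoder, whose cost is the source variance. *)
have Dcoo : (\int[P]_t (Y t ^+ 2 * 1)%:E < +oo)%E.
  rewrite -DcE.
  have [g0 g0E] : {g0 : policy R | forall x, g0 x = 0}.
    by apply: policy_of_fun; exact: measurable_cst.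
  apply: (le_lt_trans (fg g0)).
  rewrite /decoder_cost expectation.unlock.
  have -> : (\int[P]_t ((m t - g0 (channel_output m w f t)) ^+ 2)%:E =
      \int[P]_t (m t ^+ 2)%:E)%E.
    by apply: eq_integral => t _; rewrite g0E subr0.
  by rewrite (integral_source_sqr sm0 hm) ltry.
have oneoo : (\int[P]_t (1 : R)%:E < +oo)%E.
  by rewrite integral_cst//= probability_setT mule1 ltry.
have m1 : measurable_fun setT (fun _ : T => 1 : R) by exact: measurable_cst.
have YE c := integral_sqr_subr_weighted c mY m1 (fun _ => ler01) oneoo Dcoo.
have one : fine (\int[P]_t (1 : R)%:E)%E = 1.
  by rewrite integral_cst//= probability_setT mule1.
move: YE Dcoo; rewrite one -DcE.
set e := fine (\int[P]_t (Y t * 1)%:E)%E => YE Dcoo.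
have Dfin : decoder_cost m w f g \is a fin_num.
  by rewrite ge0_fin_numE ?decoder_cost_ge0.
(* Adding the mean error [e] to the decoder lowers its cost by [e ^+ 2]. *)
have e0 : e = 0.
  have [g' g'E] : {g' : policy R | forall x, g' x = g x + e}.
    by apply: policy_of_fun; apply: measurable_funD => //; exact: measurable_funP.
  have := fg g'; rewrite -(fineK Dfin).
  have -> : (decoder_cost m w f g' = \int[P]_t ((Y t - e) ^+ 2 * 1)%:E)%E.
    rewrite /decoder_cost expectation.unlock; apply: eq_integral => t _.
    by rewrite g'E mulr1 /Y opprD addrA.
  by rewrite YE lee_fin; nra.
have mf2 : measurable_fun setT (fun t => (f (m t) ^+ 2)%:E).
  apply/measurable_EFinP; apply: measurable_funX.
  by apply: measurableT_comp; exact: measurable_funP.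
rewrite /encoder_cost expectation.unlock /power.
transitivity (\int[P]_t (((Y t - b) ^+ 2 * 1)%:E
    + lambda%:E * (f (m t) ^+ 2)%:E))%E.
  by apply: eq_integral => t _; rewrite -EFinM -EFinD mulr1.
have Yb0 t : (0 <= ((Y t - b) ^+ 2 * 1)%:E)%E by rewrite lee_fin mulr1 sqr_ge0.
rewrite ge0_integralD//; last 3 first.
- apply/measurable_EFinP; apply: measurable_funM => //; apply: measurable_funX.
  exact: measurable_funB.
- by move=> t _; rewrite -EFinM lee_fin mulr_ge0 ?sqr_ge0// ltW.
- exact: measurable_funeM.
rewrite ge0_integralZl//; last 2 first.
- by move=> t _; rewrite lee_fin sqr_ge0.
- by rewrite lee_fin ltW.
rewrite YE e0 -[in RHS](fineK Dfin) -EFinD; congr (_%:E + _)%E; ring.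
Qed.

(* [S] is the variance of the output in the optimal linear pair; it equals [vw]
   when the encoder stays silent. *)
Definition output_var : R := Num.max vw (Num.sqrt (vm * vw / lambda)).
Local Notation S := output_var.
Definition error_var : R := vm * vw / S.
Local Notation D := error_var.
Definition encoder_gain : R := Num.sqrt ((S - vw) / vm).
(** The regression coefficient of the source on the output: covariance [encoder_gain * vm] over
    variance [S]. *)
Definition decoder_gain : R := encoder_gain * vm / S.
(** Intercept, at zero power, of a tangent line: the error [vm * vw / V] is convex in the output
    variance [V], with slope [- D / S] at [V = S], so error plus [D / S] times the power [V - vw] is
    least at [S], with this value. *)
Definition optimal_cost : R := 2 * D - D / S * vw.

Let S_gt0 : 0 < S. Proof. by rewrite /output_var lt_max vw0. Qed.
Let D_gt0 : 0 < D. Proof. by rewrite !mulr_gt0// invr_gt0. Qed.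

Let vw_le_S : vw <= S. Proof. by rewrite /output_var le_max lexx. Qed.

(** At [S] the marginal reduction of the error does not exceed the price [lambda] of power. *)
Let slope_le : D / S <= lambda.
Proof.
have h : vm * vw / lambda <= S ^+ 2.
  have q0 : 0 <= vm * vw / lambda by rewrite divr_ge0 ?mulr_ge0 ?ltW.
  have qS : Num.sqrt (vm * vw / lambda) <= S by rewrite /output_var le_max lexx orbT.
  rewrite -[leLHS](sqr_sqrtr q0); apply: lerXn2r => //; rewrite nnegrE.
    exact: sqrtr_ge0.
  exact: ltW.
move: h; rewrite /error_var ler_pdivrMr// => h.
by rewrite -mulrA -invfM -expr2 ler_pdivrMr ?exprn_gt0// (mulrC lambda).
Qed.

(** Complementary slackness: either the encoder is silent or the marginal reduction equals
    [lambda]. *)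
Let slope_power : (S - vw) * (lambda - D / S) = 0.
Proof.
rewrite /error_var /output_var; have [Sw|Sw] := leP (Num.sqrt (vm * vw / lambda)) vw.
  by rewrite subrr mul0r.
set s := Num.sqrt _; have s0 : 0 < s by exact: lt_trans vw0 Sw.
have s2 : s ^+ 2 = vm * vw / lambda.
  by rewrite sqr_sqrtr// divr_ge0 ?mulr_ge0 ?ltW.
rewrite -mulrA -invfM -expr2 s2 invf_div mulrCA divff ?mulr1 ?subrr ?mulr0//.
by rewrite mulf_neq0 ?gt_eqF.
Qed.

Let encoder_gain_sqr : encoder_gain ^+ 2 * vm = S - vw.
Proof.
rewrite sqr_sqrtr ?divfK ?gt_eqF//.
by rewrite divr_ge0 ?subr_ge0// ltW.
Qed.

Let sS := Num.sqrt S.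
Let sD := Num.sqrt D.
Let sS0 : 0 < sS. Proof. by rewrite sqrtr_gt0. Qed.
Let sD0 : 0 < sD. Proof. by rewrite sqrtr_gt0. Qed.
Let sS2 : sS ^+ 2 = S. Proof. by rewrite sqr_sqrtr// ltW. Qed.
Let sD2 : sD ^+ 2 = D. Proof. by rewrite sqr_sqrtr// ltW. Qed.

Let sDS : sD * sS = sm * sw.
Proof.
by rewrite -!sqrtrM ?ltW// /error_var divfK// gt_eqF.
Qed.

Let gapE' f g : (gap m w sm sw sD sS f g + 1 =
  ((D *+ 2)^-1)%:E * decoder_cost m w f g
  + ((S *+ 2)^-1)%:E * (power f + vw%:E))%E.
Proof. by rewrite (gapE sm0 sw0 sD0 sS0 sDS hm hw hind f g) sD2 sS2 sw2. Qed.

(** The gap identity says that the error plus [D / S] times the power is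
    [optimal_cost + 2 * D * gap]; [slope_le] passes from [D / S] to [lambda]. *)
Lemma decoder_plus_power_ge f g :
  (optimal_cost%:E <= decoder_cost m w f g + lambda%:E * power f)%E /\
  ((decoder_cost m w f g + lambda%:E * power f <= optimal_cost%:E)%E ->
   gap m w sm sw sD sS f g = 0%E).
Proof.
have := gapE' f g.
have := gap_ge0 m w sm sw sD sS f g.
have := decoder_cost_ge0 f g; have := power_ge0 f.
set G := gap _ _ _ _ _ _ _ _.
case: (power f) => [p| |]//.
- case: (decoder_cost m w f g) => [c| |]//.
  + case: G => [G| |]//; rewrite !lee_fin => p0 c0 G0.
    rewrite -!(EFinM, EFinD) => -[] E.
    have H : c + D / S * p = optimal_cost + 2 * D * G.
      have -> : G = (D *+ 2)^-1 * c + (S *+ 2)^-1 * (p + vw) - 1 by rewrite -E addrK.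
      by rewrite /optimal_cost; field; rewrite !gt_eqF.
    have H1 := ler_wpM2r p0 slope_le.
    have H2 : 0 <= 2 * D * G.
      by apply: mulr_ge0 => //; apply: mulr_ge0 => //; exact: ltW.
    split; first by lra.
    move=> H3; congr EFin.
    have : 2 * D * G <= 0 by lra.
    have DD : 0 < 2 * D by exact: mulr_gt0.
    rewrite (pmulr_rle0 _ DD) => G0'.
    by apply/eqP; rewrite eq_le G0 G0'.
  + by move=> *; rewrite -EFinM addye// leey; split.
(* Infinite power: since [lambda > 0] the sum is [+oo], so the bound is trivial and the equality
   case void. *)
- move=> _ c0 _ _; rewrite gt0_muley ?lte_fin// addey; last first.
    by rewrite gt_eqF// (lt_le_trans _ c0)// ltNyr.
  by rewrite leey; split.
Qed.

(** The error is [(1 - K * A) * m - K * w], a sum of independent centered terms. *)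
Lemma decoder_cost_linear (f g : policy R) (A K : R) :
  (forall x, f x = A * x) -> (forall y, g y = K * y) ->
  decoder_cost m w f g = ((1 - K * A) ^+ 2 * vm + K ^+ 2 * vw)%:E.
Proof.
move=> fE gE; rewrite /decoder_cost expectation.unlock /channel_output.
have mF : @measurable_fun _ _ (mR * mR)%type _ setT
    (fun z => ((z.1 - K * (A * z.1 + z.2)) ^+ 2)%:E).
  apply/measurable_EFinP; apply: measurable_funX; apply: measurable_funB => //.
  by apply: measurable_funM => //; apply: measurable_funD => //; exact: measurable_funM.
have F0 (z : mR * mR) : (0 <= ((z.1 - K * (A * z.1 + z.2)) ^+ 2)%:E)%E.
  by rewrite lee_fin sqr_ge0.
transitivity (\int[P]_t ((m t - K * (A * m t + w t)) ^+ 2)%:E)%E.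
  by apply: eq_integral => t _; rewrite gE fE.
apply: (etrans (ge0_integral_joint_law hm hw hind mF F0)).
have mx2 : @measurable_fun _ _ mR _ setT (fun x => (x ^+ 2)%:E).
  by apply/measurable_EFinP; exact: measurable_funX.
transitivity (\int[normal_prob 0 sm]_x
   (((1 - K * A) ^+ 2)%:E * (x ^+ 2)%:E + (K ^+ 2 * vw)%:E))%E.
  apply: eq_integral => x _ /=.
  transitivity (((1 - K * A) * x) ^+ 2 + (- K) ^+ 2 * sw ^+ 2)%:E.
    rewrite -(integral_normal_sqr_affine _ _ sw0).
    by apply: eq_integral => v _; congr (_ ^+ 2)%:E; ring.
  by rewrite sw2 -EFinM -EFinD; congr EFin; ring.
rewrite ge0_integralD//; last 3 first.
- by move=> x _; rewrite -EFinM lee_fin mulr_ge0 ?sqr_ge0.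
- exact: measurable_funeM.
- by move=> x _; rewrite lee_fin mulr_ge0 ?sqr_ge0// ltW.
rewrite ge0_integralZl//; last 2 first.
- by move=> x _; rewrite lee_fin sqr_ge0.
- by rewrite lee_fin sqr_ge0.
rewrite integral_normal_sqr// sm2 integral_cst//=.
by rewrite probability_setT mule1 -EFinM -EFinD.
Qed.

Lemma power_linear (f : policy R) (A : R) :
  (forall x, f x = A * x) -> power f = (A ^+ 2 * vm)%:E.
Proof.
move=> fE; rewrite /power -sm2 EFinM -(integral_source_sqr sm0 hm).
rewrite -ge0_integralZl//; last 3 first.
- apply/measurable_EFinP; apply: measurable_funX.
  exact: (@measurable_funP _ _ T R setT m).
- by move=> t _; rewrite lee_fin sqr_ge0.
- by rewrite lee_fin sqr_ge0.
by apply: eq_integral => t _; rewrite fE exprMn EFinM.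
Qed.

(** * Optimality of the linear pair *)

Section optimal_pair.
Variables f g : policy R.
Hypothesis fE : forall x, f x = encoder_gain * x.
Hypothesis gE : forall y, g y = decoder_gain * y.

Lemma decoder_cost_optimal : decoder_cost m w f g = D%:E.
Proof.
rewrite (decoder_cost_linear fE gE); congr EFin.
have -> : 1 - decoder_gain * encoder_gain = vw / S.
  transitivity (1 - encoder_gain ^+ 2 * vm / S).
    by rewrite /decoder_gain; field; rewrite gt_eqF.
  by rewrite encoder_gain_sqr; field; rewrite gt_eqF.
have -> : decoder_gain ^+ 2 = (encoder_gain ^+ 2 * vm) * vm / S ^+ 2.
  by rewrite /decoder_gain; field; rewrite gt_eqF.
by rewrite encoder_gain_sqr /error_var; field; rewrite gt_eqF.
Qed.

(** The encoder has power [S - vw], so the gap identity makes the cost of any decoder of finite cost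
    equal to [D + 2 * D * gap], at least [D]. *)
Lemma best_response_optimal : best_response f g.
Proof.
move=> g'; rewrite decoder_cost_optimal.
have := gapE' f g'; have := gap_ge0 m w sm sw sD sS f g'.
have := decoder_cost_ge0 f g'.
rewrite (power_linear fE) encoder_gain_sqr -EFinD subrK.
case: (decoder_cost m w f g') => [c| |]//; last by move=> *; rewrite leey.
case: (gap _ _ _ _ _ _ _ _) => [G| |]//; rewrite !lee_fin => c0 G0.
rewrite -!(EFinM, EFinD) => -[] E.
have -> : c = D + 2 * D * G.
  have -> : G = (D *+ 2)^-1 * c + (S *+ 2)^-1 * S - 1 by rewrite -E addrK.
  by field; rewrite !gt_eqF.
rewrite lerDl; apply: mulr_ge0 => //.
by apply: mulr_ge0 => //; exact: ltW.
Qed.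

Lemma optimal_costE :
  (D%:E + lambda%:E * power f = optimal_cost%:E)%E.
Proof.
rewrite (power_linear fE) encoder_gain_sqr -EFinM -EFinD; congr EFin.
move: slope_power; rewrite mulrBr => /eqP; rewrite subr_eq0 => /eqP E.
rewrite [lambda * _]mulrC E /optimal_cost; field.
by rewrite gt_eqF.
Qed.

End optimal_pair.

Lemma linear_equilibrium : exists (ge : policy R) (br : policy R -> policy R),
  [/\ stackelberg_equilibrium m w b lambda ge br, linear_policy ge
    & linear_policy (br ge)].
Proof.
have [f fE] := linear_policy_of encoder_gain.
have [g gE] := linear_policy_of decoder_gain.
pose brf h := projT1 (cid (exists_best_response sm0 sw0 hm hw hind h)).
have brfP h : best_response h (brf h) by exact: projT2 (cid _).
(* The posterior mean answers all other encoders; at [f] the exactly linear [g] is selected, since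
   best responses may differ on null sets. *)
pose br h := if `[< h = f >] then g else brf h.
have brE : br f = g by rewrite /br asboolT.
have brP h : best_response h (br h).
  rewrite /br; case: asboolP => [->|_]; last exact: brfP.
  exact: best_response_optimal.
exists f, br; split; last 2 first.
- by exists encoder_gain.
- by exists decoder_gain; rewrite brE.
split=> // h; rewrite !encoder_cost_best_response//.
rewrite brE (decoder_cost_optimal fE gE) addeAC (optimal_costE fE) addeAC.
by apply: leeD => //; exact: (decoder_plus_power_ge h (br h)).1.
Qed.

Lemma ae_source (A : R -> Prop) :
  {ae normal_prob 0 sm, forall x : mR, A x} -> {ae P, forall t, A (m t)}.
Proof.
move=> [N [mN N0 AN]]; exists (m @^-1` N); split.
- by rewrite -[X in measurable X]setTI; exact: (@measurable_funP _ _ T R setT m).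
- by rewrite -N0; exact: hm.
- by move=> t /= nA; exact: AN.
Qed.

(** Gaussian noise makes the output law absolutely continuous for every encoder, so Lebesgue-null
    sets are not observed. *)
Lemma ae_output (f : policy R) (A : R -> Prop) :
  {ae leb, forall y : mR, A y} -> {ae P, forall t, A (channel_output m w f t)}.
Proof.
move=> [N [mN N0 AN]]; exists (channel_output m w f @^-1` N); split.
- by rewrite -[X in measurable X]setTI; exact: measurable_output.
- have mNy : measurable (channel_output m w f @^-1` N).
    by rewrite -[X in measurable X]setTI; exact: measurable_output.
  have mF : @measurable_fun _ _ (mR * mR)%type _ setT (fun z => (\1_N z.2 : R)%:E).
    apply/measurable_EFinP.
    by apply: (@measurableT_comp _ _ _ (mR * mR)%type mR R (\1_N)).
  have F0 (z : mR * mR) : (0 <= (\1_N z.2 : R)%:E)%E by rewrite lee_fin.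
  have mpdf : @measurable_fun _ _ (mR * mR)%type mR setT
      (fun z => normal_pdf (f z.1) sw z.2).
    under eq_fun do rewrite normal_pdf_shift ?gt_eqF//.
    apply: (@measurableT_comp _ _ _ (mR * mR)%type mR mR (normal_pdf 0 sw)).
      exact: measurable_normal_pdf.
    apply: measurable_funB => //.
    have mf : @measurable_fun _ _ mR mR setT f.
      exact: (@measurable_funP _ _ R R setT f).
    by apply: measurableT_comp mf _.
  pose h z := ((\1_N z.2 : R)%:E * (normal_pdf (f z.1) sw z.2)%:E)%E.
  have mh : @measurable_fun _ _ (mR * mR)%type _ setT h.
    by apply: emeasurable_funM => //; exact/measurable_EFinP.
  have mI : @measurable_fun _ _ mR _ setT
      (fun y => \int[normal_prob 0 sm]_x h (x, y))%E.
    exact: (@measurable_fun_integral_param _ _ mR mR R (normal_prob 0 sm) h).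
  have I0 : ae_eq leb setT (fun y => \int[normal_prob 0 sm]_x h (x, y))%E (cst 0%E).
    exists N; split=> // y /= /not_implyP[_ hy]; apply: contrapT => Ny; apply: hy.
    rewrite (_ : (fun x => h (x, y)) = cst 0%E) ?integral0//.
    apply/funext => x; rewrite /h /= indicE (_ : (y \in N) = false) ?mul0e//.
    by apply/negbTE; rewrite notin_setE.
  have -> : P (channel_output m w f @^-1` N) =
      (\int[P]_t (\1_N (f (m t) + w t) : R)%:E)%E.
    by rewrite -[in LHS](setIT (_ @^-1` _)) -integral_indic.
  apply: (etrans (ge0_integral_output_law sw0 hm hw hind f mF F0)).
  rewrite -[RHS]((ae_eq_integral_abs leb measurableT mI).2 I0).
  apply: eq_integral => y _; rewrite gee0_abs//; apply: integral_ge0 => x _.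
  by rewrite /h -EFinM lee_fin mulr_ge0 ?normal_pdf_ge0.
- by move=> t /= nA; exact: AN.
Qed.

Lemma equilibrium_linear (ge : policy R) (br : policy R -> policy R) :
  stackelberg_equilibrium m w b lambda ge br ->
  linear_policy_as P m ge /\
  linear_policy_as P (channel_output m w ge) (br ge).
Proof.
move=> [brP geP].
have [f fE] := linear_policy_of encoder_gain.
have [g gE] := linear_policy_of decoder_gain.
have := geP f.
rewrite (encoder_cost_best_response (brP ge)) (encoder_cost_best_response (brP f)).
rewrite addeAC [leRHS]addeAC leeD2rE// => le.
(* Compare with the linear encoder [f]: its response [br f] costs the decoder no more than [g]. The
   lower bound is thus attained and the gap vanishes. *)
have {}le : (decoder_cost m w ge (br ge) + lambda%:E * power ge
    <= optimal_cost%:E)%E.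
  apply: (le_trans le); rewrite -(optimal_costE fE) leeD2r//.
  by rewrite -(decoder_cost_optimal fE gE); exact: brP.
have /(gap_eq0_log_ratio sw0 hm hw hind) := (decoder_plus_power_ge ge (br ge)).2 le.
move=> /(log_ratio_eq0_linear sm0 sw0 sD0 sS0 sDS)[A [K [hA hK]]].
split; [exists A|exists K].
- exact: (ae_source hA).
- exact: (ae_output ge hK).
Qed.

End equilibria.

Theorem mainTheorem8 (R : realType) (d : measure_display)
    (T : measurableType d) (P : probability T R) (m w : {RV P >-> R})
    (vm vw b lambda : R)
    (hvm : 0 < vm) (hvw : 0 < vw) (hlambda : 0 < lambda)
    (hm : centered_gaussian m vm) (hw : centered_gaussian w vw)
    (hind : independent_RVs m w) :
  (exists (ge : policy R) (br : policy R -> policy R),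
     [/\ stackelberg_equilibrium m w b lambda ge br,
         linear_policy ge
       & linear_policy (br ge)]) /\
  (forall (ge : policy R) (br : policy R -> policy R),
     stackelberg_equilibrium m w b lambda ge br ->
     linear_policy_as P m ge /\
     linear_policy_as P (channel_output m w ge) (br ge)).
Proof.
split; first exact: linear_equilibrium hvm hvw hlambda hm hw hind.
by move=> ge br; exact: equilibrium_linear hvm hvw hlambda hm hw hind ge br.
Qed.
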